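(* The representation variety $\mathrm{Hom}(\mathbb Z^2,\mathrm{Heis}_0)$ is isomorphic, as a real algebraic variety, to $V(x_1y_2-x_2y_1)\times\mathbb R^2$, where $V(x_1y_2-x_2y_1)\subset\mathbb R^4$ is the hypersurface $\{(x_1,x_2,y_1,y_2)\in\mathbb R^4: x_1y_2-x_2y_1=0\}$.
   Context: $\mathrm{Heis}_0$ is the real Heisenberg group of upper triangular unipotent real $3\times3$ matrices, an algebraic subset of the space of real $3\times 3$ matrices. The set $\mathrm{Hom}(\mathbb Z^2,\mathrm{Heis}_0)$ is given the structure of a real algebraic variety by evaluation on the two standard generators of $\mathbb Z^2$, which identifies it with the subvariety of commuting pairs in $\mathrm{Heis}_0\times\mathrm{Heis}_0$. *)

(* Defs.v *)
From HB Require Import structures.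
From mathcomp Require Import all_boot all_order all_algebra.
From mathcomp Require Import boolp reals mpoly ring.

Set Implicit Arguments.
Unset Strict Implicit.
Unset Printing Implicit Defensive.

Import GRing.Theory.
Local Open Scope ring_scope.

Definition mpeval (R : realType) (n : nat) (p : {mpoly R[n]}) (x : 'rV[R]_n) : R :=
  p.@[fun i => x 0 i].

Definition in_zero_set (R : realType) (n : nat) (ps : seq {mpoly R[n]}) (x : 'rV[R]_n) : bool :=
  all (fun p => mpeval p x == 0) ps.

(* An affine real algebraic variety: a set identified by [coord] with the set
   of real points of an algebraic subset of R^n.  Only the set of real points
   matters; the chosen equations are not part of the structure. *)
Record algVariety (R : realType) := AlgVariety {
  ambient_dim : nat;
  point :> Type;
  coord : point -> 'rV[R]_ambient_dim;
  coord_inj : injective coord;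
  coord_algebraic : exists ps : seq {mpoly R[ambient_dim]},
    forall x, (exists v, coord v = x) <-> in_zero_set ps x
}.

(* Morphisms of affine varieties are the restrictions of polynomial maps. *)
Definition polynomial_map (R : realType) (X Y : algVariety R) (f : X -> Y) : Prop :=
  exists F : 'I_(ambient_dim Y) -> {mpoly R[ambient_dim X]},
    forall v : X, coord (f v) = \row_i mpeval (F i) (coord v).

Definition isomorphic (R : realType) (X Y : algVariety R) : Prop :=
  exists (f : X -> Y) (g : Y -> X),
    [/\ polynomial_map f, polynomial_map g, cancel f g & cancel g f].

Definition zero_set (R : realType) (n : nat) (ps : seq {mpoly R[n]}) : Type :=
  {x : 'rV[R]_n | in_zero_set ps x}.

Lemma zero_set_algebraic (R : realType) (n : nat) (ps : seq {mpoly R[n]}) :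
  exists qs : seq {mpoly R[n]},
    forall x, (exists v : zero_set ps, val v = x) <-> in_zero_set qs x.
Proof.
exists ps => x; split=> [[v <-]|hx]; first exact: valP.
by exists (exist _ x hx).
Qed.

Definition zeroVariety (R : realType) (n : nat) (ps : seq {mpoly R[n]}) : algVariety R :=
  @AlgVariety R n (zero_set ps) val val_inj (zero_set_algebraic ps).

Lemma affine_space_algebraic (R : realType) (n : nat) :
  exists ps : seq {mpoly R[n]},
    forall x : 'rV[R]_n, (exists v : 'rV[R]_n, v = x) <-> in_zero_set ps x.
Proof. by exists [::] => x; split=> // _; exists x. Qed.

Definition affineSpace (R : realType) (n : nat) : algVariety R :=
  @AlgVariety R n 'rV[R]_n id (fun _ _ => id) (affine_space_algebraic R n).

Definition prod_coord (R : realType) (X Y : algVariety R) (v : X * Y) :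
    'rV[R]_(ambient_dim X + ambient_dim Y) :=
  row_mx (coord v.1) (coord v.2).

Lemma prod_coord_inj (R : realType) (X Y : algVariety R) :
  injective (@prod_coord R X Y).
Proof.
by move=> [x y] [x' y'] /eq_row_mx[/coord_inj /= -> /coord_inj /= ->].
Qed.

Lemma mpeval_comp (R : realType) (m n : nat) (s : 'I_m -> 'I_n)
    (p : {mpoly R[m]}) (x : 'rV[R]_n) :
  mpeval (comp_mpoly [tuple 'X_(s i) | i < m] p) x = mpeval p (\row_i x 0 (s i)).
Proof.
rewrite /mpeval comp_mpoly_meval; apply: meval_eq => i.
by rewrite !tnth_map tnth_ord_tuple mxE mevalXU.
Qed.

Lemma prod_coord_algebraic (R : realType) (X Y : algVariety R) :
  exists ps : seq {mpoly R[ambient_dim X + ambient_dim Y]},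
    forall x, (exists v : X * Y, prod_coord v = x) <-> in_zero_set ps x.
Proof.
have [ps hX] := coord_algebraic X; have [qs hY] := coord_algebraic Y.
pose liftp m n (s : 'I_m -> 'I_n) (p : {mpoly R[m]}) :=
  comp_mpoly [tuple 'X_(s i) | i < m] p.
exists ([seq liftp _ _ (lshift (ambient_dim Y)) p | p <- ps]
     ++ [seq liftp _ _ (@rshift (ambient_dim X) _) q | q <- qs]) => x.
have -> : in_zero_set ([seq liftp _ _ (lshift (ambient_dim Y)) p | p <- ps]
     ++ [seq liftp _ _ (@rshift (ambient_dim X) _) q | q <- qs]) x
   = in_zero_set ps (lsubmx x) && in_zero_set qs (rsubmx x).
  rewrite /in_zero_set all_cat !all_map; congr (_ && _); apply: eq_all => p /=;
  by rewrite mpeval_comp; congr (mpeval p _ == 0); apply/rowP => i; rewrite !mxE.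
split.
  case=> -[v w] <-; rewrite row_mxKl row_mxKr /=.
  by apply/andP; split; [apply/hX; exists v | apply/hY; exists w].
case/andP => /hX[v hv] /hY[w hw]; exists (v, w).
by rewrite /prod_coord /= hv hw hsubmxK.
Qed.

Definition prodVariety (R : realType) (X Y : algVariety R) : algVariety R :=
  AlgVariety (@prod_coord_inj R X Y) (prod_coord_algebraic X Y).

Definition upper_unipotent (R : realType) (A : 'M[R]_3) : bool :=
  is_trig_mx A^T && [forall i, A i i == 1].

Record heis (R : realType) := Heis {
  heis_mx :> 'M[R]_3;
  heis_mxP : upper_unipotent heis_mx
}.

HB.instance Definition _ (R : realType) := [isSub for @heis_mx R].
HB.instance Definition _ (R : realType) := [Choice of heis R by <:].

(* The upper triangular unipotent matrix with entries a, c; b above the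
   diagonal; auxiliary to the proofs below. *)
Definition umx (R : realType) (a b c : R) : 'M[R]_3 :=
  \matrix_(i, j) nth 0 (nth [::] [:: [:: 1; a; c]; [:: 0; 1; b]; [:: 0; 0; 1]] i) j.

Lemma forall_I3 (P : 'I_3 -> Prop) :
  P ord0 -> P (lift ord0 ord0) -> P (lift ord0 (lift ord0 ord0)) -> forall i, P i.
Proof.
move=> h0 h1 h2 [[|[|[|//]]] hi]; [move: h0|move: h1|move: h2];
by congr P; apply: val_inj.
Qed.

Lemma umx_unipotent (R : realType) (a b c : R) : upper_unipotent (umx a b c).
Proof.
apply/andP; split.
  apply/is_trig_mxP; elim/forall_I3; elim/forall_I3 => //= _; by rewrite !mxE.
by apply/forallP; elim/forall_I3; rewrite mxE.
Qed.

Lemma upper_unipotentP (R : realType) (A : 'M[R]_3) :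
  upper_unipotent A -> exists a b c, A = umx a b c.
Proof.
case/andP=> /is_trig_mxP hT /forallP hD.
exists (A ord0 (lift ord0 ord0)), (A (lift ord0 ord0) (lift ord0 (lift ord0 ord0))),
  (A ord0 (lift ord0 (lift ord0 ord0))).
apply/matrixP; elim/forall_I3; elim/forall_I3; rewrite [RHS]mxE //=;
  try exact/eqP/hD.
- by have := hT ord0 (lift ord0 ord0) isT; rewrite mxE.
- by have := hT ord0 (lift ord0 (lift ord0 ord0)) isT; rewrite mxE.
- by have := hT (lift ord0 ord0) (lift ord0 (lift ord0 ord0)) isT; rewrite mxE.
Qed.

Lemma umxM (R : realType) (a b c a' b' c' : R) :
  umx a b c *m umx a' b' c' = umx (a + a') (b + b') (c + c' + a * b').
Proof.
apply/matrixP; elim/forall_I3; elim/forall_I3;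
  by rewrite !mxE !big_ord_recl big_ord0 !mxE /=; ring.
Qed.

Lemma umx1 (R : realType) : umx 0 0 0 = 1%:M :> 'M[R]_3.
Proof. by apply/matrixP; elim/forall_I3; elim/forall_I3; rewrite !mxE. Qed.

Lemma umxV (R : realType) (a b c : R) :
  umx a b c \in unitmx /\ invmx (umx a b c) = umx (- a) (- b) (a * b - c).
Proof.
have h : umx a b c *m umx (- a) (- b) (a * b - c) = 1%:M.
  by rewrite umxM -umx1; congr umx; ring.
have [hu _] := mulmx1_unit h; split=> //.
by rewrite -[LHS]mulmx1 -h mulKmx.
Qed.

Lemma heis1_subproof (R : realType) : upper_unipotent (1%:M : 'M[R]_3).
Proof. by rewrite -umx1 umx_unipotent. Qed.

Lemma heisM_subproof (R : realType) (A B : heis R) : upper_unipotent (A *m B).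
Proof.
have [a [b [c ->]]] := upper_unipotentP (heis_mxP A).
have [a' [b' [c' ->]]] := upper_unipotentP (heis_mxP B).
by rewrite umxM umx_unipotent.
Qed.

Lemma heisV_subproof (R : realType) (A : heis R) : upper_unipotent (invmx A).
Proof.
have [a [b [c ->]]] := upper_unipotentP (heis_mxP A).
by rewrite (umxV a b c).2 umx_unipotent.
Qed.

Lemma heis_unitmx (R : realType) (A : heis R) : (A : 'M[R]_3) \in unitmx.
Proof.
by have [a [b [c ->]]] := upper_unipotentP (heis_mxP A); case: (umxV a b c).
Qed.

Definition heis_one (R : realType) : heis R := Heis (heis1_subproof R).
Definition heis_mul (R : realType) (A B : heis R) : heis R := Heis (heisM_subproof A B).
Definition heis_inv (R : realType) (A : heis R) : heis R := Heis (heisV_subproof A).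

Lemma heis_mulA (R : realType) : associative (@heis_mul R).
Proof. by move=> A B C; apply/val_inj/mulmxA. Qed.

Lemma heis_mul1 (R : realType) : left_id (heis_one R) (@heis_mul R).
Proof. by move=> A; apply/val_inj/mul1mx. Qed.

Lemma heis_mulr1 (R : realType) : right_id (heis_one R) (@heis_mul R).
Proof. by move=> A; apply/val_inj/mulmx1. Qed.

Lemma heis_mulV (R : realType) : left_inverse (heis_one R) (@heis_inv R) (@heis_mul R).
Proof. by move=> A; apply/val_inj/mulVmx/heis_unitmx. Qed.

Lemma heis_mulrV (R : realType) : right_inverse (heis_one R) (@heis_inv R) (@heis_mul R).
Proof. by move=> A; apply/val_inj/mulmxV/heis_unitmx. Qed.

HB.instance Definition _ (R : realType) := isGroup.Build (heis R)
  (@heis_mulA R) (@heis_mul1 R) (@heis_mulr1 R) (@heis_mulV R) (@heis_mulrV R).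

(* Group homomorphisms from an abelian group, written additively, to a group
   written multiplicatively. *)
Record groupHom (A : zmodType) (G : groupType) := GroupHom {
  hom_fun :> A -> G;
  hom_funD : forall u v, hom_fun (u + v) = (hom_fun u * hom_fun v)%g
}.

Lemma groupHom_ext (A : zmodType) (G : groupType) (r s : groupHom A G) : r =1 s -> r = s.
Proof.
case: r s => [r hr] [s hs] /= /funext rs; move: rs hr hs => -> hr hs.
by congr GroupHom; apply: Prop_irrelevance.
Qed.

Lemma groupHom0 (A : zmodType) (G : groupType) (r : groupHom A G) : r 0 = 1%g.
Proof. by apply: (mulgI (r 0)); rewrite -hom_funD addr0 mulg1. Qed.

Lemma groupHomN (A : zmodType) (G : groupType) (r : groupHom A G) u : r (- u) = (r u)^-1%g.
Proof. by apply: (mulgI (r u)); rewrite -hom_funD subrr groupHom0 mulgV. Qed.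

Definition zexpg (G : groupType) (g : G) (m : int) : G :=
  match m with Posz n => (g ^+ n)%g | Negz n => (g ^- n.+1)%g end.

Lemma groupHomMz (A : zmodType) (G : groupType) (r : groupHom A G) u m :
  r (u *~ m) = zexpg (r u) m.
Proof.
have hn n : r (u *+ n) = (r u ^+ n)%g.
  by elim: n => [|n ih]; rewrite ?mulr0n ?groupHom0 // mulrS hom_funD ih expgS.
by case: m => n; rewrite /= -?hn // -groupHomN.
Qed.

Definition Z2_gen1 : (int * int)%type := (1, 0).
Definition Z2_gen2 : (int * int)%type := (0, 1).

Lemma Z2_decomp (u : (int * int)%type) : u = Z2_gen1 *~ u.1 + Z2_gen2 *~ u.2.
Proof.
have e1 n : Z2_gen1 *+ n = (n%:Z, 0).
  by elim: n => // n ih; rewrite mulrS ih; congr (_, _); rewrite ?addr0 // intS.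
have e2 n : Z2_gen2 *+ n = (0, n%:Z).
  by elim: n => // n ih; rewrite mulrS ih; congr (_, _); rewrite ?addr0 // intS.
have f1 m : Z2_gen1 *~ m = (m, 0).
  by case: m => n; rewrite /intmul e1 //; congr (_, _); rewrite /= ?oppr0 ?NegzE.
have f2 m : Z2_gen2 *~ m = (0, m).
  by case: m => n; rewrite /intmul e2 //; congr (_, _); rewrite /= ?oppr0 ?NegzE.
by case: u => a b; rewrite f1 f2; congr (_, _); rewrite /= ?addr0 ?add0r.
Qed.

Lemma zexpgD (G : groupType) (g : G) (m n : int) :
  zexpg g (m + n) = (zexpg g m * zexpg g n)%g.
Proof.
have hS k : zexpg g (k + 1) = (zexpg g k * g)%g.
  case: k => k; first by rewrite -PoszD addn1 /= expgSr.
  rewrite NegzE -addn1 PoszD opprD addrK.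
  case: k => [|k]; first by rewrite oppr0 /= expg0 expg1 mulVg.
  by rewrite -NegzE /= addn0 (expgS _ k.+1) invgM mulgVK.
have hB k : zexpg g (k - 1) = (zexpg g k * g^-1)%g.
  by apply: (mulIg g); rewrite -hS subrK mulgVK.
elim: n => [|n ih|n ih].
- by rewrite addr0 /= expg0 mulg1.
- by rewrite intS [1 + _]addrC addrA hS ih hS mulgA.
- by rewrite intS opprD [-1 - _]addrC addrA !hB ih mulgA.
Qed.

Lemma zexpg_commute (G : groupType) (g h : G) (m : int) :
  commute g h -> commute g (zexpg h m).
Proof.
by move=> gh; case: m => n; [apply: commuteX | apply/commuteV/commuteX].
Qed.

Definition heis_rep (R : realType) : Type := groupHom (int * int)%type (heis R).

(* Evaluation on the two generators, in Mat_3(R) x Mat_3(R) = R^(9 + 9). *)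
Definition heis_rep_coord (R : realType) (r : heis_rep R) : 'rV[R]_(3 * 3 + 3 * 3) :=
  row_mx (mxvec (r Z2_gen1)) (mxvec (r Z2_gen2)).

Lemma heis_rep_coord_inj (R : realType) : injective (@heis_rep_coord R).
Proof.
move=> r s /eq_row_mx[/(can_inj mxvecK)/val_inj h1 /(can_inj mxvecK)/val_inj h2].
apply: groupHom_ext => u.
by rewrite (Z2_decomp u) !hom_funD !groupHomMz h1 h2.
Qed.

Lemma heis_rep_coord_image (R : realType) (A B : 'M[R]_3) :
  (exists r : heis_rep R, heis_rep_coord r = row_mx (mxvec A) (mxvec B)) <->
  [/\ upper_unipotent A, upper_unipotent B & A *m B = B *m A].
Proof.
split.
  case=> r /eq_row_mx[/(can_inj mxvecK) <- /(can_inj mxvecK) <-].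
  split; try exact: heis_mxP.
  have : (r Z2_gen1 * r Z2_gen2 = r Z2_gen2 * r Z2_gen1)%g.
    by rewrite -!hom_funD addrC.
  by move/(congr1 (@heis_mx R)).
case=> hA hB hAB; pose a := Heis hA; pose b := Heis hB.
have cab : commute a b by apply: val_inj.
have hD (u v : (int * int)%type) : (zexpg a (u + v).1 * zexpg b (u + v).2 =
   zexpg a u.1 * zexpg b u.2 * (zexpg a v.1 * zexpg b v.2))%g.
  rewrite !zexpgD -!mulgA; congr (_ * _)%g; rewrite !mulgA; congr (_ * _)%g.
  exact/commute_sym/zexpg_commute/commute_sym/zexpg_commute/commute_sym.
exists (GroupHom hD); rewrite /heis_rep_coord /=.
by rewrite mulmx1 mul1mx.
Qed.

Lemma heis_rep_algebraic (R : realType) :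
  exists ps : seq {mpoly R[3 * 3 + 3 * 3]},
    forall x, (exists r : heis_rep R, heis_rep_coord r = x) <-> in_zero_set ps x.
Proof.
pose XA : 'M[{mpoly R[3 * 3 + 3 * 3]}]_3 :=
  \matrix_(i, j) 'X_(lshift _ (mxvec_index i j)).
pose XB : 'M[{mpoly R[3 * 3 + 3 * 3]}]_3 :=
  \matrix_(i, j) 'X_(rshift _ (mxvec_index i j)).
pose eqU (X : 'M[{mpoly R[3 * 3 + 3 * 3]}]_3) (ij : 'I_3 * 'I_3) :=
  if (ij.2 <= ij.1)%N then X ij.1 ij.2 - (ij.1 == ij.2)%:R else 0.
pose eqC (ij : 'I_3 * 'I_3) := (XA *m XB - XB *m XA) ij.1 ij.2.
exists ([seq eqU XA ij | ij : 'I_3 * 'I_3] ++ [seq eqU XB ij | ij : 'I_3 * 'I_3]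
  ++ [seq eqC ij | ij : 'I_3 * 'I_3]) => x.
have [A [B ->]] : exists A B : 'M[R]_3, x = row_mx (mxvec A) (mxvec B).
  by exists (vec_mx (lsubmx x)), (vec_mx (rsubmx x)); rewrite !vec_mxK hsubmxK.
rewrite heis_rep_coord_image /in_zero_set !all_cat.
set y := row_mx _ _.
have eA i j : mpeval (XA i j) y = A i j.
  by rewrite /mpeval mxE mevalXU row_mxEl mxvecE.
have eB i j : mpeval (XB i j) y = B i j.
  by rewrite /mpeval mxE mevalXU row_mxEr mxvecE.
have hU (X : 'M[{mpoly R[3 * 3 + 3 * 3]}]_3) (M : 'M[R]_3) : (forall i j, mpeval (X i j) y = M i j) ->
    all (fun p => mpeval p y == 0) [seq eqU X ij | ij : 'I_3 * 'I_3] = upper_unipotent M.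
  move=> e; apply/allP/andP.
    move=> h; have {}h (i j : 'I_3) : (j <= i)%N -> M i j = (i == j)%:R.
      move=> hji; have /h : eqU X (i, j) \in [seq eqU X ij | ij : 'I_3 * 'I_3].
        by apply: map_f; rewrite mem_enum.
      rewrite /eqU /= hji /mpeval mevalB -/(mpeval _ _) e mevalMn meval1 subr_eq0.
      by move/eqP.
    split; first by apply/is_trig_mxP => i j hij; rewrite mxE h 1?ltnW // -val_eqE gtn_eqF.
    by apply/forallP => i; rewrite h // eqxx.
  case=> /is_trig_mxP hT /forallP hD p /mapP[[i j] _ ->]; rewrite /eqU /=.
  case: leqP => hji; last by rewrite /mpeval meval0.
  rewrite /mpeval mevalB -/(mpeval _ _) e mevalMn meval1 subr_eq0.
  case: (eqVneq i j) => [->|nij]; first exact: hD.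
  by have := hT j i; rewrite mxE => -> //; rewrite ltn_neqAle hji val_eqE eq_sym nij.
have hC : all (fun p => mpeval p y == 0) [seq eqC ij | ij : 'I_3 * 'I_3]
   = (A *m B == B *m A).
  have e i j : mpeval (eqC (i, j)) y = (A *m B - B *m A) i j.
    rewrite /eqC /mpeval !mxE /= mevalB !(raddf_sum (meval _)) /=; congr (_ - _);
    by apply: eq_bigr => k _; rewrite mevalM -!/(mpeval _ _) ?eA ?eB.
  rewrite -subr_eq0; apply/allP/eqP => [h|h p /mapP[[i j] _ ->]].
    apply/matrixP => i j; rewrite -e [RHS]mxE; apply/eqP/h.
    by apply: map_f; rewrite mem_enum.
  by rewrite e h mxE.
rewrite (hU _ _ eA) (hU _ _ eB) hC.
split; first by case=> -> -> ->; rewrite eqxx.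
by case/and3P => -> -> /eqP.
Qed.

Definition heisRepVariety (R : realType) : algVariety R :=
  AlgVariety (@heis_rep_coord_inj R) (heis_rep_algebraic R).

(* x1 y2 - x2 y1 in the coordinates (x1, x2, y1, y2) of R^4. *)
Definition det_poly (R : realType) : {mpoly R[4]} :=
  let x1 := 'X_(@Ordinal 4 0 isT) in let x2 := 'X_(@Ordinal 4 1 isT) in
  let y1 := 'X_(@Ordinal 4 2 isT) in let y2 := 'X_(@Ordinal 4 3 isT) in
  x1 * y2 - x2 * y1.

(* Main.v *)
Require Import Defs.
From mathcomp Require Import all_boot all_order all_algebra reals mpoly.
From mathcomp Require Import boolp ring.
(* so that [coord] is the coordinate map of a variety, not coordinates on a basis *)
Import Defs.

(** Write the images of the two generators as the unipotent matrices with
entries [a, c; b] and [a', c'; b'] above the diagonal.  By the Heisenberg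
multiplication law [umxM] the two products agree in every entry except the
corner, where they differ by [a * b' - a' * b].  So a pair commutes exactly when
[(a, b, a', b')] lies on the hypersurface, while the corner entries [c], [c']
are free ([umx_commute]).

Both varieties are therefore parametrized by the same tuples
[(a, b, c, a', b', c')] with [a * b' = b * a'] ([heis_rep_param],
[det_product_param]).  In one direction the isomorphism reads off six matrix
entries, and in the other it fills two matrices with these six numbers and the
constants [0] and [1]; both maps are polynomial.  That they are mutually
inverse is checked on ambient coordinates, by [isomorphic_by_coordinates]. *)

Set Implicit Arguments.
Unset Strict Implicit.
Unset Printing Implicit Defensive.

Import GRing.Theory.
Local Open Scope ring_scope.

Definition polymap (R : realType) (m n : nat) (F : 'rV[{mpoly R[m]}]_n)
    (x : 'rV[R]_m) : 'rV[R]_n :=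
  map_mx (fun p => mpeval p x) F.

(** Since coordinates are injective, two polynomial maps between the ambient
spaces that invert each other along matched pairs of points induce an
isomorphism; the maps between the points are obtained by choice. *)
Lemma isomorphic_by_coordinates (R : realType) (X Y : algVariety R)
    (F : 'rV[{mpoly R[ambient_dim X]}]_(ambient_dim Y))
    (G : 'rV[{mpoly R[ambient_dim Y]}]_(ambient_dim X)) :
  (forall v : X, exists w : Y,
     coord w = polymap F (coord v) /\ coord v = polymap G (coord w)) ->
  (forall w : Y, exists v : X,
     coord v = polymap G (coord w) /\ coord w = polymap F (coord v)) ->
  isomorphic X Y.
Proof.
move=> /choice[f hf] /choice[g hg]; exists f, g; split.
- by exists (F 0) => v; rewrite (hf v).1; apply/rowP => i; rewrite !mxE.
- by exists (G 0) => w; rewrite (hg w).1; apply/rowP => i; rewrite !mxE.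
- by move=> v; apply: coord_inj; rewrite (hg _).1 -(hf v).2.
- by move=> w; apply: coord_inj; rewrite (hf _).1 -(hg w).2.
Qed.

Lemma umx_commute (R : realType) (a b c a' b' c' : R) :
  umx a b c *m umx a' b' c' = umx a' b' c' *m umx a b c <-> a * b' = b * a'.
Proof.
rewrite !umxM; split=> [/matrixP/(_ ord0 ord_max)|h].
  rewrite !mxE /= [c' + c]addrC => /addrI ->; exact: mulrC.
by congr umx; rewrite 1?[LHS]addrC // h; ring.
Qed.

Definition heis_pair_row (R : realType) (a b c a' b' c' : R) :
    'rV[R]_(3 * 3 + 3 * 3) :=
  row_mx (mxvec (umx a b c)) (mxvec (umx a' b' c')).

Definition row_of_seq (T : nmodType) (n : nat) (s : seq T) : 'rV[T]_n :=
  \row_i nth 0 s i.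

Definition det_product_row (R : realType) (a b c a' b' c' : R) : 'rV[R]_(4 + 2) :=
  row_mx (row_of_seq 4 [:: a; b; a'; b']) (row_of_seq 2 [:: c; c']).

Lemma heis_rep_param (R : realType) (x : 'rV[R]_(3 * 3 + 3 * 3)) :
  (exists r : heisRepVariety R, coord r = x) <->
  exists a b c a' b' c', a * b' = b * a' /\ x = heis_pair_row a b c a' b' c'.
Proof.
split.
  case=> r <-; have := (heis_rep_coord_image (r Z2_gen1) (r Z2_gen2)).1.
  case; first by exists r.
  move=> /upper_unipotentP[a [b [c eA]]] /upper_unipotentP[a' [b' [c' eB]]].
  rewrite eA eB umx_commute => h; exists a, b, c, a', b', c'; split=> //.
  by rewrite /heis_pair_row -eA -eB.
case=> [a [b [c [a' [b' [c' [h ->]]]]]]]; apply/heis_rep_coord_image.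
by split; try exact: umx_unipotent; apply/umx_commute.
Qed.

Lemma in_zero_set_det (R : realType) (a b a' b' : R) :
  in_zero_set [:: det_poly R] (row_of_seq 4 [:: a; b; a'; b']) <->
  a * b' = b * a'.
Proof.
rewrite /in_zero_set /= andbT /mpeval /det_poly mevalB !mevalM !mevalXU !mxE /=.
by rewrite subr_eq0; split=> /eqP.
Qed.

Lemma row_of_seqE (T : nmodType) (n : nat) (x : 'rV[T]_n.+1) :
  x = row_of_seq n.+1 (mkseq (fun k => x 0 (inord k)) n.+1).
Proof. by apply/rowP => i; rewrite mxE nth_mkseq // inord_val. Qed.

Lemma det_product_param (R : realType) (x : 'rV[R]_(4 + 2)) :
  (exists w : prodVariety (zeroVariety [:: det_poly R]) (affineSpace R 2),
     coord w = x) <->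
  exists a b c a' b' c', a * b' = b * a' /\ x = det_product_row a b c a' b' c'.
Proof.
split.
  case=> -[[y hy] z] <-; rewrite /coord /= /prod_coord /=.
  move: hy; rewrite (row_of_seqE y) (row_of_seqE z) => /in_zero_set_det h.
  (* the sequences of coordinates reduce to explicit lists, which supply the
     six parameters *)
  by do 6 eexists; split; first exact: h.
case=> [a [b [c [a' [b' [c' [/in_zero_set_det h ->]]]]]]].
pose y : zero_set [:: det_poly R] := Sub _ h.
by exists (y, row_of_seq 2 [:: c; c']).
Qed.

Definition read_entries (R : realType) : 'rV[{mpoly R[3 * 3 + 3 * 3]}]_(4 + 2) :=
  let i0 := ord0 : 'I_3 in
  let i1 := lift ord0 ord0 : 'I_3 in
  let i2 := lift ord0 (lift ord0 ord0) : 'I_3 in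
  let A i j := 'X_(lshift (3 * 3) (mxvec_index i j)) in
  let B i j := 'X_(rshift (3 * 3) (mxvec_index i j)) in
  row_mx (row_of_seq 4 [:: A i0 i1; A i1 i2; B i0 i1; B i1 i2])
         (row_of_seq 2 [:: A i0 i2; B i0 i2]).

(** The counterpart of [umx] over a polynomial ring, which evaluation
specializes to [umx] itself ([map_poly_umx]). *)
Definition poly_umx (R : realType) (n : nat) (a b c : {mpoly R[n]}) :
    'M[{mpoly R[n]}]_3 :=
  \matrix_(i, j) nth 0 (nth [::] [:: [:: 1; a; c]; [:: 0; 1; b]; [:: 0; 0; 1]] i) j.

Definition fill_matrices (R : realType) : 'rV[{mpoly R[4 + 2]}]_(3 * 3 + 3 * 3) :=
  let u k := 'X_(lshift 2 (inord k : 'I_4)) in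
  let t k := 'X_(rshift 4 (inord k : 'I_2)) in
  row_mx (mxvec (poly_umx (u 0%N) (u 1%N) (t 0%N)))
         (mxvec (poly_umx (u 2%N) (u 3%N) (t 1%N))).

Lemma map_row_of_seq (S T : nmodType) (f : S -> T) (n : nat) (s : seq S) :
  size s = n -> map_mx f (row_of_seq n s) = row_of_seq n (map f s).
Proof. by move=> hs; apply/rowP => i; rewrite !mxE (nth_map 0) ?hs. Qed.

Lemma read_entriesE (R : realType) (a b c a' b' c' : R) :
  polymap (read_entries R) (heis_pair_row a b c a' b' c') =
  det_product_row a b c a' b' c'.
Proof.
rewrite /polymap map_row_mx !map_row_of_seq //= /mpeval !mevalXU.
by rewrite !row_mxEl !row_mxEr !mxvecE !mxE.
Qed.

Lemma map_poly_umx (R : realType) (n : nat) (a b c : {mpoly R[n]}) (x : 'rV[R]_n) :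
  map_mx (fun p => mpeval p x) (poly_umx a b c) =
  umx (mpeval a x) (mpeval b x) (mpeval c x).
Proof.
by apply/matrixP; elim/forall_I3; elim/forall_I3;
  rewrite !mxE //= /mpeval ?meval0 ?meval1.
Qed.

Lemma fill_matricesE (R : realType) (a b c a' b' c' : R) :
  polymap (fill_matrices R) (det_product_row a b c a' b' c') =
  heis_pair_row a b c a' b' c'.
Proof.
rewrite /polymap map_row_mx !map_mxvec !map_poly_umx /mpeval !mevalXU.
by rewrite !row_mxEl !row_mxEr !mxE !inordK.
Qed.

Theorem mainTheorem4 (R : realType) :
  isomorphic (heisRepVariety R)
    (prodVariety (zeroVariety [:: det_poly R]) (affineSpace R 2)).
Proof.
pose Y := prodVariety (zeroVariety [:: det_poly R]) (affineSpace R 2).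
apply: (@isomorphic_by_coordinates R (heisRepVariety R) Y
  (read_entries R) (fill_matrices R)).
  move=> v; have [|a [b [c [a' [b' [c' [h ev]]]]]]] := (heis_rep_param (coord v)).1.
    by exists v.
  have [|w ew] := (det_product_param (det_product_row a b c a' b' c')).2.
    by exists a, b, c, a', b', c'.
  by exists w; rewrite ev ew read_entriesE fill_matricesE.
move=> w; have [|a [b [c [a' [b' [c' [h ew]]]]]]] := (det_product_param (coord w)).1.
  by exists w.
have [|v ev] := (heis_rep_param (heis_pair_row a b c a' b' c')).2.
  by exists a, b, c, a', b', c'.
by exists v; rewrite ev ew read_entriesE fill_matricesE.
Qed.
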